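(* Let $(A,\le,0,1)$ be a bounded MLUB-complete poset, $(T,R)$ a time frame with $R$ reflexive, and $P,F,H,G$ the tense operators induced by $(T,R)$. Then for every $B\in\mathcal P_+(A^T)$: $P(B)\le_2(P*F)(B)$, $F(B)\le_2(F*P)(B)$, $H(B)\le_1(H*P)(B)$, $G(B)\le_1(G*P)(B)$, $(P*H)(B)\le_2P(B)$, $(F*H)(B)\le_2F(B)$, $H(B)\le_1(H*F)(B)$, $G(B)\le_1(G*F)(B)$, $(P*G)(B)\le_2P(B)$, $(F*G)(B)\le_2F(B)$, $(H*G)(B)\le_1H(B)$, $(G*H)(B)\le_1G(B)$.
   Context: For a poset and $X\subseteq A$: $L(X)$, $U(X)$ the sets of lower/upper bounds, $\operatorname{Max}X,\operatorname{Min}X$ the maximal/minimal elements. MLUB-complete: for every nonempty $M$, every upper bound of $M$ lies above a minimal upper bound and every lower bound below a maximal lower bound. $\mathcal P_+(X)$ = nonempty subsets. For subsets $X,Y$: $X\le_1Y$ iff every $x\in X$ lies below some $y\in Y$; $X\le_2Y$ iff every $y\in Y$ lies above some $x\in X$. $A^T$ is ordered componentwise; each $Z\in(\mathcal P_+A)^T$ is identified with $\varphi(Z)=\{q\in A^T\mid q(t)\in Z(t)\ \forall t\}\subseteq A^T$ for comparisons. A time frame is $(T,R)$, $T\ne\emptyset$, $R\subseteq T^2$. The induced tense operators $P,F,H,G:\mathcal P_+(A^T)\to(\mathcal P_+A)^T$ are $P(B)(s)=\operatorname{Min}U(\{q(t)\mid q\in B,tRs\})$, $F(B)(s)=\operatorname{Min}U(\{q(t)\mid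 q\in B,sRt\})$, $H(B)(s)=\operatorname{Max}L(\{q(t)\mid q\in B,tRs\})$, $G(B)(s)=\operatorname{Max}L(\{q(t)\mid q\in B,sRt\})$. For $X,Y$ among these, $X*Y=X\circ\varphi\circ Y$. *)

(* Defs.v *)
From HB Require Import structures.
From mathcomp Require Import all_boot all_order.
From mathcomp Require Import boolp classical_sets.

Set Implicit Arguments.
Unset Strict Implicit.
Unset Printing Implicit Defensive.

Import Order.TTheory.
Local Open Scope classical_set_scope.
Local Open Scope order_scope.

Record nonempty_set (X : Type) := NonemptySet {
  nonempty_carrier :> set X;
  nonempty_carrierP : nonempty_carrier !=set0 }.

Section Poset.
Context {d : Order.disp_t} {A : porderType d}.
Implicit Types X Y M : set A.

Definition Max X : set A := [set x | X x /\ forall y, X y -> x <= y -> y = x].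
Definition Min X : set A := [set x | X x /\ forall y, X y -> y <= x -> y = x].

Definition le1 X Y : Prop := forall x, X x -> exists2 y, Y y & x <= y.
Definition le2 X Y : Prop := forall y, Y y -> exists2 x, X x & x <= y.

End Poset.

Definition MLUB_complete (d : Order.disp_t) (A : porderType d) : Prop :=
  forall M : set A, M !=set0 ->
    (forall u, ubound M u -> exists2 m, Min (ubound M) m & m <= u) /\
    (forall l, lbound M l -> exists2 m, Max (lbound M) m & l <= m).

(* Boundedness covers the case M = set0, which MLUB-completeness leaves out:
   Min (ubound set0) = {0} and Max (lbound set0) = {1}. *)
Lemma Min_ubound_neq0 (d : Order.disp_t) (A : tbPOrderType d)
  (hA : MLUB_complete A) (M : set A) : Min (ubound M) !=set0.
Proof.
have [->|/set0P M0] := eqVneq M set0.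
  by exists \bot; split=> [x //|y _ y0]; apply/eqP; rewrite eq_le y0 le0x.
have [+ _] := hA M M0; case/(_ \top) => [x _|m mM _]; first exact: lex1.
by exists m.
Qed.

Lemma Max_lbound_neq0 (d : Order.disp_t) (A : tbPOrderType d)
  (hA : MLUB_complete A) (M : set A) : Max (lbound M) !=set0.
Proof.
have [->|/set0P M0] := eqVneq M set0.
  by exists \top; split=> [x //|y _ y1]; apply/eqP; rewrite eq_le y1 lex1.
have [_ +] := hA M M0; case/(_ \bot) => [x _|m mM _]; first exact: le0x.
by exists m.
Qed.

Record time_frame := TimeFrame {
  time :> Type;
  time_inhabited : inhabited time;
  tense_rel : time -> time -> Prop }.

Section Phi.
Context {T : Type} {d : Order.disp_t} {A : porderType d}.
Implicit Types Z W : T -> nonempty_set A.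

Lemma phi_neq0 Z : [set q : T -> A | forall t, (Z t : set A) (q t)] !=set0.
Proof.
have [q qZ] := choice (fun t => nonempty_carrierP (Z t)).
by exists q.
Qed.

Definition phi Z : nonempty_set (T -> A) := NonemptySet (phi_neq0 Z).

(* T -> A carries the library's componentwise order. *)
Definition tle1 Z W : Prop := le1 (phi Z) (phi W).
Definition tle2 Z W : Prop := le2 (phi Z) (phi W).

End Phi.

Section TenseOperators.
Context {d : Order.disp_t} {A : tbPOrderType d}.
Variables (hA : MLUB_complete A) (T : time_frame).
Local Notation R := (@tense_rel T).
Implicit Types (B : nonempty_set (T -> A)) (s t : T).

Definition past_values B s : set A :=
  [set a | exists q t, [/\ (B : set (T -> A)) q, R t s & a = q t]].
Definition future_values B s : set A :=
  [set a | exists q t, [/\ (B : set (T -> A)) q, R s t & a = q t]].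

Definition tenseP B s : nonempty_set A :=
  NonemptySet (Min_ubound_neq0 hA (past_values B s)).
Definition tenseF B s : nonempty_set A :=
  NonemptySet (Min_ubound_neq0 hA (future_values B s)).
Definition tenseH B s : nonempty_set A :=
  NonemptySet (Max_lbound_neq0 hA (past_values B s)).
Definition tenseG B s : nonempty_set A :=
  NonemptySet (Max_lbound_neq0 hA (future_values B s)).

End TenseOperators.

Definition tense_comp (T : Type) (d : Order.disp_t) (A : porderType d)
  (X Y : nonempty_set (T -> A) -> T -> nonempty_set A) :
  nonempty_set (T -> A) -> T -> nonempty_set A := X \o phi \o Y.

Declare Scope tense_scope.
Delimit Scope tense_scope with tense.
Notation "X * Y" := (tense_comp X Y) : tense_scope.
Notation "Z <=_1 W" := (tle1 Z W) (at level 70, no associativity) : tense_scope.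
Notation "Z <=_2 W" := (tle2 Z W) (at level 70, no associativity) : tense_scope.

(* Main.v *)
Require Import Defs.
From HB Require Import structures.
From mathcomp Require Import all_boot all_order.
From mathcomp Require Import boolp classical_sets.

(** P and F carry [<=_1] on families of time-dependent propositions to [<=_2]
    on their values, and H and G carry [<=_2] to [<=_1], because the relevant
    sets of bounds are then included in one another and in a bounded
    MLUB-complete poset every bound is dominated by an extremal one.  When R is
    reflexive, every member of B lies below every selection of P(B) or F(B) and
    above every selection of H(B) or G(B).  Each of the twelve inequalities
    applies one of these monotonicities to one of these comparisons. *)

Set Implicit Arguments.
Unset Strict Implicit.
Unset Printing Implicit Defensive.

Import Order.TTheory.
Local Open Scope classical_set_scope.
Local Open Scope order_scope.
Local Open Scope tense_scope.

Section Bounds.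
Context {d : Order.disp_t} {A : tbPOrderType d}.
Hypothesis hA : MLUB_complete A.
Implicit Types M N : set A.

(** Extends MLUB-completeness to [M = set0], where [\bot] is the minimal upper bound; in an
    arbitrary frame an instant may have no predecessor or successor. *)
Lemma Min_ubound_le M u : ubound M u -> exists2 m, Min (ubound M) m & m <= u.
Proof.
have [->|/set0P M0] := eqVneq M set0; last exact: ((hA M0).1 u).
move=> _; exists \bot; last exact: le0x.
by split=> [x //|y _ y0]; apply/eqP; rewrite eq_le y0 le0x.
Qed.

Lemma Max_lbound_ge M l : lbound M l -> exists2 m, Max (lbound M) m & l <= m.
Proof.
have [->|/set0P M0] := eqVneq M set0; last exact: ((hA M0).2 l).
move=> _; exists \top; last exact: lex1.
by split=> [x //|y _ y1]; apply/eqP; rewrite eq_le y1 lex1.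
Qed.

(** By transitivity every upper bound of [N] also bounds [M], and so lies above a minimal upper
    bound of [M]. *)
Lemma le2_Min_ubound M N :
  le1 M N -> le2 (Min (ubound M)) (Min (ubound N)).
Proof.
move=> MN u [uN _]; apply: Min_ubound_le => x /MN[y Ny xy].
exact: le_trans xy (uN y Ny).
Qed.

Lemma le1_Max_lbound M N :
  le2 M N -> le1 (Max (lbound M)) (Max (lbound N)).
Proof.
move=> MN l [lM _]; apply: Max_lbound_ge => y /MN[x Mx xy].
exact: le_trans (lM x Mx) xy.
Qed.

End Bounds.

Section PointwiseComparison.
Context {T : Type} {d : Order.disp_t} {A : porderType d}.
Implicit Types Z W : T -> nonempty_set A.

Lemma tle1_pointwise Z W : (forall t, le1 (Z t) (W t)) -> Z <=_1 W.
Proof.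
move=> ZW x xZ.
(* Choice assembles the witnesses at each instant into one selection of [W]. *)
have /choice[y yP] : forall t, exists a, (W t : set A) a /\ x t <= a.
  by move=> t; have [a ? ?] := ZW t _ (xZ t); exists a.
by exists y; [move=> t; case: (yP t)|apply/lefP => t; case: (yP t)].
Qed.

Lemma tle2_pointwise Z W : (forall t, le2 (Z t) (W t)) -> Z <=_2 W.
Proof.
move=> ZW y yW.
have /choice[x xP] : forall t, exists a, (Z t : set A) a /\ a <= y t.
  by move=> t; have [a ? ?] := ZW t _ (yW t); exists a.
by exists x; [move=> t; case: (xP t)|apply/lefP => t; case: (xP t)].
Qed.

End PointwiseComparison.

Section Monotonicity.
Context {d : Order.disp_t} {A : tbPOrderType d}.
Variables (hA : MLUB_complete A) (T : time_frame).
Implicit Types B C : nonempty_set (T -> A).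

Lemma le1_past_values B C s :
  le1 B C -> le1 (past_values B s) (past_values C s).
Proof.
move=> BC _ [q [t [/BC[r Cr /lefP qr] Rts ->]]].
by exists (r t) => //; exists r, t.
Qed.

Lemma le1_future_values B C s :
  le1 B C -> le1 (future_values B s) (future_values C s).
Proof.
move=> BC _ [q [t [/BC[r Cr /lefP qr] Rst ->]]].
by exists (r t) => //; exists r, t.
Qed.

Lemma le2_past_values B C s :
  le2 B C -> le2 (past_values B s) (past_values C s).
Proof.
move=> BC _ [r [t [/BC[q Bq /lefP qr] Rts ->]]].
by exists (q t) => //; exists q, t.
Qed.

Lemma le2_future_values B C s :
  le2 B C -> le2 (future_values B s) (future_values C s).
Proof.
move=> BC _ [r [t [/BC[q Bq /lefP qr] Rst ->]]].
by exists (q t) => //; exists q, t.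
Qed.

Lemma tenseP_mono B C : le1 B C -> tenseP hA B <=_2 tenseP hA C.
Proof.
move=> BC; apply: tle2_pointwise => s.
exact/(le2_Min_ubound hA)/le1_past_values.
Qed.

Lemma tenseF_mono B C : le1 B C -> tenseF hA B <=_2 tenseF hA C.
Proof.
move=> BC; apply: tle2_pointwise => s.
exact/(le2_Min_ubound hA)/le1_future_values.
Qed.

Lemma tenseH_mono B C : le2 B C -> tenseH hA B <=_1 tenseH hA C.
Proof.
move=> BC; apply: tle1_pointwise => s.
exact/(le1_Max_lbound hA)/le2_past_values.
Qed.

Lemma tenseG_mono B C : le2 B C -> tenseG hA B <=_1 tenseG hA C.
Proof.
move=> BC; apply: tle1_pointwise => s.
exact/(le1_Max_lbound hA)/le2_future_values.
Qed.

End Monotonicity.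

Section Reflexive.
Context {d : Order.disp_t} {A : tbPOrderType d}.
Variables (hA : MLUB_complete A) (T : time_frame).
Hypothesis hR : forall t : T, tense_rel t t.
Implicit Types B C : nonempty_set (T -> A).

(** As members of [nonempty_set] are nonempty, this implies both [le1], which [P] and [F] consume,
    and [le2], which [H] and [G] consume. *)
Definition all_le B C : Prop :=
  forall q r : T -> A, (B : set _) q -> (C : set _) r -> q <= r.

Lemma all_le_le1 B C : all_le B C -> le1 B C.
Proof.
move=> BC q Bq; have [r Cr] := nonempty_carrierP C.
by exists r => //; apply: BC.
Qed.

Lemma all_le_le2 B C : all_le B C -> le2 B C.
Proof.
move=> BC r Cr; have [q Bq] := nonempty_carrierP B.
by exists q => //; apply: BC.
Qed.

(** Reflexivity makes [q t] one of the past values of [B] at [t], and [r t] is an upper bound of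
    these. *)
Lemma all_le_phi_tenseP B : all_le B (phi (tenseP hA B)).
Proof.
by move=> q r Bq rP; apply/lefP => t; have [+ _] := rP t; apply; exists q, t.
Qed.

Lemma all_le_phi_tenseF B : all_le B (phi (tenseF hA B)).
Proof.
by move=> q r Bq rF; apply/lefP => t; have [+ _] := rF t; apply; exists q, t.
Qed.

Lemma all_ge_phi_tenseH B : all_le (phi (tenseH hA B)) B.
Proof.
by move=> r q rH Bq; apply/lefP => t; have [+ _] := rH t; apply; exists q, t.
Qed.

Lemma all_ge_phi_tenseG B : all_le (phi (tenseG hA B)) B.
Proof.
by move=> r q rG Bq; apply/lefP => t; have [+ _] := rG t; apply; exists q, t.
Qed.

End Reflexive.

Theorem theorem3p12 (d : Order.disp_t) (A : tbPOrderType d)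
  (hA : MLUB_complete A) (T : time_frame)
  (hR : forall t : T, tense_rel t t) (B : nonempty_set (T -> A)) :
  let P := @tenseP d A hA T in
  let F := @tenseF d A hA T in
  let H := @tenseH d A hA T in
  let G := @tenseG d A hA T in
  (P B <=_2 (P * F) B /\ F B <=_2 (F * P) B /\
   H B <=_1 (H * P) B /\ G B <=_1 (G * P) B) /\
  ((P * H) B <=_2 P B /\ (F * H) B <=_2 F B /\
   H B <=_1 (H * F) B /\ G B <=_1 (G * F) B) /\
  ((P * G) B <=_2 P B /\ (F * G) B <=_2 F B /\
   (H * G) B <=_1 H B /\ (G * H) B <=_1 G B).
Proof.
move=> P F H G.
have BP : all_le B (phi (P B)) by exact: all_le_phi_tenseP.
have BF : all_le B (phi (F B)) by exact: all_le_phi_tenseF.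
have HB : all_le (phi (H B)) B by exact: all_ge_phi_tenseH.
have GB : all_le (phi (G B)) B by exact: all_ge_phi_tenseG.
(* In each goal both sides share their outer operator, which selects the monotonicity lemma; what
   remains is one of [BP], [BF], [HB], [GB]. *)
split; [|split]; (split; [|split; [|split]]);
  by [apply/tenseP_mono/all_le_le1 | apply/tenseF_mono/all_le_le1
     |apply/tenseH_mono/all_le_le2 | apply/tenseG_mono/all_le_le2].
Qed.
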